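(* Let $q$ be a complex number with $0<|q|<1$. For each $n\in\{1,2,\dots,9\}$ let $$Y_n(q)=q^{n}\,\frac{\left(q^{19-2n},\,q^{57+2n};\,q^{76}\right)_\infty}{\left(q^{19+2n},\,q^{57-2n};\,q^{76}\right)_\infty}.$$ Then for every $n\in\{1,2,\dots,9\}$, $$\frac{1}{Y_n(q)}+Y_n(q)=\frac{\phi(-q^{19})\,f(q^{2n},q^{38-2n})}{q^{n}\,\psi(q^{38})\,f(-q^{19-2n},-q^{19+2n})}$$ and $$\frac{1}{Y_n(q)}-Y_n(q)=\frac{\phi(q^{19})\,f(-q^{2n},-q^{38-2n})}{q^{n}\,\psi(q^{38})\,f(-q^{19-2n},-q^{19+2n})}.$$
   Context: For complex $\lambda$ and $|q|<1$, $(\lambda;q)_\infty=\prod_{j\ge 0}(1-\lambda q^j)$ and $(\lambda_1,\lambda_2;q)_\infty=(\lambda_1;q)_\infty(\lambda_2;q)_\infty$. Ramanujan's general theta function is $f(a,b)=\sum_{j=-\infty}^{\infty}a^{j(j+1)/2}b^{j(j-1)/2}$ for $|ab|<1$. Special cases: $\phi(q)=f(q,q)=\sum_{j=-\infty}^\infty q^{j^2}$ and $\psi(q)=f(q,q^3)=\sum_{j=0}^\infty q^{j(j+1)/2}$. The functions $Y_n(q)$ are the continued fractions of order seventy-six. *)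

(* Defs.v *)
From mathcomp Require Import all_boot all_order all_algebra.
From mathcomp Require Import all_classical all_reals all_analysis.
Set Implicit Arguments.
Unset Strict Implicit.
Unset Printing Implicit Defensive.
Import Order.TTheory GRing.Theory Num.Theory numFieldNormedType.Exports.
Local Open Scope classical_set_scope.
Local Open Scope ring_scope.

(* Stated over a [numFieldType], whose topology is the one induced by its norm:
   [R[i]] inherits that topology only through its [numFieldType] structure. *)
Definition qpoch (K : numFieldType) (a q : K) : K :=
  lim ((\prod_(0 <= j < m) (1 - a * q ^+ j)) @[m --> \oo]).

Definition qpoch2 (K : numFieldType) (a1 a2 q : K) : K :=
  qpoch a1 q * qpoch a2 q.

(* [j (j + 1)] and [j (j - 1)] are even and nonnegative for every [j : int],
   so both divisions are exact and no negative power occurs. *)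
Definition theta_term (K : numFieldType) (a b : K) (j : int) : K :=
  a ^ ((j * (j + 1)) %/ 2)%Z * b ^ ((j * (j - 1)) %/ 2)%Z.

(* The bilateral sum is the sum of its halves [0 <= j] and [j <= -1]. *)
Definition theta (K : numFieldType) (a b : K) : K :=
  lim (series (fun k : nat => theta_term a b k%:Z) @ \oo) +
  lim (series (fun k : nat => theta_term a b (- k.+1%:Z)) @ \oo).

Definition phi (K : numFieldType) (q : K) : K := theta q q.

Definition psi (K : numFieldType) (q : K) : K := theta q (q ^+ 3).

Definition Y (K : numFieldType) (n : nat) (q : K) : K :=
  q ^+ n * (qpoch2 (q ^+ (19 - 2 * n)) (q ^+ (57 + 2 * n)) (q ^+ 76) /
            qpoch2 (q ^+ (19 + 2 * n)) (q ^+ (57 - 2 * n)) (q ^+ 76)).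

(* Main.v *)
(* Put [Q = q ^ 19] and [x = q ^ (2 n)]. By the Jacobi triple product,
   [Y_n = q ^ n * B / A] with [A = f(- Q x, - Q^3 / x)] and
   [B = f(- Q / x, - Q^3 x)], so [1 / Y_n +- Y_n = (A^2 +- x B^2) / (q ^ n A B)].
   Expanding [A^2], [x B^2] and [A B] as double sums over [Z * Z] and passing to
   the variables [s = i + j], [d = i - j], which have the same parity, gives
   [A^2 +- x B^2 = phi(-+ Q) f(+- x, +- Q^2 / x)] and
   [A B = psi(Q^2) f(- Q / x, - Q x)].
   The triple product is the limit, by dominated convergence, of its finite form
   with q-binomial coefficients. *)
Require Import Defs.
From mathcomp Require Import all_boot all_order all_algebra.
From mathcomp Require Import finmap complex.
From mathcomp Require Import all_classical all_reals all_analysis.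
From mathcomp Require Import summability.
From mathcomp Require Import ring zify.
Set Implicit Arguments.
Unset Strict Implicit.
Unset Printing Implicit Defensive.
Import Order.TTheory GRing.Theory Num.Theory numFieldNormedType.Exports.
Local Open Scope ring_scope.
Local Open Scope classical_set_scope.

#[local] Existing Instance totally_filter.

(** * Unordered sums *)

(** The quadratic identities know 19 only through [Q]: they hold for all nonzero [Q], [x] with
    [|Q|], [|x|], [|Q / x|] below 1, and [1 <= n <= 9] says exactly that [0 < 2n < 19], which
    ensures this for [x = q ^ (2n)]. Both signs are treated at once by an [e] with [e * e = 1]. The
    obstacle is the change of variables in double sums: [theta] is a pair of one-sided limits, which
    a rotation of the lattice does not respect. Sums are therefore taken over arbitrary index types,
    as limits along finite subsets ordered by inclusion. Reindexing and splitting by parity then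
    need only injections, and absolute summability is needed only to multiply two sums. *)

Definition hasum (K : numFieldType) (T : choiceType) (f : T -> K) (l : K) :=
  \sum_(i <- E) f i @[E --> (@totally T)] --> l.

Lemma hasumP (K : numFieldType) (T : choiceType) (f : T -> K) (l : K) :
  hasum f l <-> forall e, 0 < e -> exists E0 : {fset T},
    forall E, (E0 `<=` E)%fset -> `|l - \sum_(i <- E) f i| < e.
Proof.
rewrite /hasum; split => [/cvgrPdist_lt h e /h [E0 _ hE]|h].
  by exists E0 => E /hE.
by apply/cvgrPdist_lt => e /h [E0 hE]; exists E0 => // E /hE.
Qed.

Lemma hasum_unique (K : numFieldType) (T : choiceType) (f : T -> K) (l m : K) :
  hasum f l -> hasum f m -> l = m.
Proof. exact: (cvg_unique (@norm_hausdorff K K)). Qed.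

Lemma eq_hasum (K : numFieldType) (T : choiceType) (f g : T -> K) (l : K) :
  f =1 g -> hasum f l -> hasum g l.
Proof. by move=> /funext ->. Qed.

Lemma hasumD (K : numFieldType) (T : choiceType) (f g : T -> K) (l m : K) :
  hasum f l -> hasum g m -> hasum (fun i => f i + g i) (l + m).
Proof.
move=> hf hg; rewrite /hasum.
under eq_fun do rewrite big_split/=.
exact: (cvgD hf hg).
Qed.

Lemma hasumZ (K : numFieldType) (T : choiceType) (c : K) (f : T -> K) (l : K) :
  hasum f l -> hasum (fun i => c * f i) (c * l).
Proof.
move=> hf; rewrite /hasum.
under eq_fun do rewrite -mulr_sumr.
exact: (cvgM (cvg_cst c) hf).
Qed.

(** The condition [h (g u) != u] describes the complement of the image of [h], so [f] extends by
    zero a family indexed by [T]. Given a finite set, its elements off the image are dropped and the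
    others pulled back by [g]. Halves of the integers and parity classes of the lattice enter by
    this route. *)
Lemma hasum_inj (K : numFieldType) (T U : choiceType) (h : T -> U) (g : U -> T)
    (f : U -> K) (l : K) :
  cancel h g -> (forall u, h (g u) != u -> f u = 0) ->
  hasum (f \o h) l -> hasum f l.
Proof.
move=> hK f0 /hasumP hf; apply/hasumP => e /hf [E0 hE].
exists [fset h t | t in E0]%fset => E sE.
pose E1 := [fset u in E | h (g u) == u]%fset.
have := hE [fset g u | u in E1]%fset.
rewrite big_imfset/=; last first.
  by move=> x y; rewrite !inE => /andP[_ /eqP <-] /andP[_ /eqP <-]; rewrite !hK => ->.
rewrite big_fset big_mkcond/=.
rewrite (eq_bigr f) => [|u _]; last first.
  by case: eqP => [->//|/eqP /f0 ->].
apply; apply/fsubsetP => t tE0; apply/imfsetP; exists (h t); rewrite ?hK//=.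
rewrite !inE hK eqxx andbT; apply: (fsubsetP sE).
by apply/imfsetP; exists t.
Qed.

Lemma big_fset_sub (K : numFieldType) (T : choiceType) (f : T -> K)
    (A B : {fset T}) : (A `<=` B)%fset ->
  \sum_(i <- B) f i = \sum_(i <- A) f i + \sum_(i <- B | i \notin A) f i.
Proof.
move=> AB; rewrite (bigID (mem A))/=; congr (_ + _).
rewrite big_fset_condE/=; apply: eq_fbigl => i.
by rewrite !inE/=; apply: andb_idl => /(fsubsetP AB).
Qed.

Lemma ler_sum_fset (K : numFieldType) (T : choiceType) (f : T -> K)
    (A B : {fset T}) : (forall i, 0 <= f i) -> (A `<=` B)%fset ->
  \sum_(i <- A) f i <= \sum_(i <- B) f i.
Proof. by move=> f0 /big_fset_sub ->; rewrite lerDl sumr_ge0. Qed.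

Lemma dist_sum_fset (K : numFieldType) (T : choiceType) (f : T -> K)
    (A B : {fset T}) : (A `<=` B)%fset ->
  `|\sum_(i <- B) f i - \sum_(i <- A) f i| <=
  \sum_(i <- B) `|f i| - \sum_(i <- A) `|f i|.
Proof.
move=> AB; rewrite (big_fset_sub f AB) (big_fset_sub (fun i => `|f i|) AB).
by rewrite [X in `|X|]addrC addKr [leRHS]addrC addKr ler_norm_sum.
Qed.

(** Once a finite set contains [g] of [F], its image contains [F]. Meant for the two projections of
    a product, whose sections freeze the other coordinate. *)
Lemma cvg_imfset (T U : choiceType) (h : T -> U) (g : U -> T) :
  cancel g h -> [fset h t | t in (E : {fset T})]%fset @[E --> (@totally T)] --> (@totally U).
Proof.
move=> gK P [F _ hF]; exists [fset g u | u in F]%fset => // E sE.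
apply: hF => /=; apply/fsubsetP => u uF; apply/imfsetP; exists (g u); rewrite ?gK//=.
by apply: (fsubsetP sE); apply/imfsetP; exists u.
Qed.

Lemma big_fsetM (K : numFieldType) (T U : choiceType) (f : T -> K) (g : U -> K)
    (A : {fset T}) (B : {fset U}) :
  \sum_(p <- (A `*` B)%fset) f p.1 * g p.2 =
  (\sum_(i <- A) f i) * (\sum_(j <- B) g j).
Proof.
rewrite big_imfset2 /=; last by move=> [x y] [x' y'] /= _ _ [<- <-].
by rewrite mulr_suml; apply: eq_bigr => i _; rewrite mulr_sumr.
Qed.

(* The sum over a finite set [E] of pairs is compared with the sum over the
   smallest rectangle containing [E]. *)
Lemma hasumM (K : numFieldType) (T U : choiceType) (t0 : T) (u0 : U)
    (f : T -> K) (g : U -> K) (l m l' m' : K) :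
  hasum f l -> hasum g m ->
  hasum (fun i => `|f i|) l' -> hasum (fun i => `|g i|) m' ->
  hasum (fun p : T * U => f p.1 * g p.2) (l * m).
Proof.
move=> hf hg hf' hg'.
pose rec (E : {fset T * U}) :=
  ([fset p.1 | p in E] `*` [fset p.2 | p in E])%fset.
have recE E : (E `<=` rec E)%fset.
  apply/fsubsetP => p pE; rewrite in_fsetM.
  by apply/andP; split; apply/imfsetP; exists p.
have c1 := @cvg_imfset _ _ (@fst T U) (fun t => (t, u0)) (fun=> erefl).
have c2 := @cvg_imfset _ _ (@snd T U) (fun u => (t0, u)) (fun=> erefl).
have cr (f1 : T -> K) (g1 : U -> K) l1 m1 : hasum f1 l1 -> hasum g1 m1 ->
    \sum_(p <- rec E) f1 p.1 * g1 p.2 @[E --> (@totally (T * U)%type)] --> l1 * m1.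
  move=> hf1 hg1.
  under eq_fun do rewrite big_fsetM.
  exact: (cvgM (cvg_comp _ _ c1 hf1) (cvg_comp _ _ c2 hg1)).
have {}cr' := cr _ _ _ _ hf' hg'.
have {}cr := cr _ _ _ _ hf hg.
apply/hasumP => e e0.
have e3 : 0 < e / 3 by rewrite divr_gt0.
have /cvgrPdist_lt /(_ _ e3) [E1 _ hE1] := cr.
have /cvgrPdist_lt /(_ _ e3) [E2 _ hE2] := cr'.
(* [E] must contain the whole rectangle [rec E2]: passing from [E] to [rec E] then costs at most the
   difference of two rectangular sums of norms, both within [e / 3] of [l' * m']. *)
exists (E1 `|` rec E2)%fset => E; rewrite fsubUset => /andP[sE1 sE2].
set S := fun E' => \sum_(p <- E') `|f p.1 * g p.2|.
have SE E' : \sum_(p <- E') `|f p.1| * `|g p.2| = S E'.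
  by apply: eq_bigr => p _; rewrite normrM.
have /= := hE1 _ sE1.
have /= := hE2 _ (fsubset_trans (recE E2) sE2).
have /= := hE2 _ (fsubset_refl E2).
rewrite !SE => h1 h2 h3.
have h4 := dist_sum_fset (fun p => f p.1 * g p.2) (recE E).
have h5 : S (rec E2) <= S E by apply: ler_sum_fset.
have h6 : S (rec E) - S E <= `|S (rec E) - S (rec E2)|.
  apply: (@le_trans _ _ (S (rec E) - S (rec E2))); first by rewrite lerB.
  rewrite ger0_norm// subr_ge0; apply: ler_sum_fset => //.
  exact: fsubset_trans (recE E).
have -> : e = e / 3 + (e / 3 + e / 3) by field.
apply: (le_lt_trans (ler_distD (\sum_(p <- rec E) f p.1 * g p.2) _ _)).
apply: ltrD => //; apply: (le_lt_trans h4); apply: (le_lt_trans h6).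
apply: (le_lt_trans (ler_distD (l' * m') _ _)).
by rewrite [X in X + _]distrC ltrD.
Qed.

Lemma in_seq_fset (T : choiceType) (s : seq T) (i : T) :
  (i \in [fset j in s]%fset) = (i \in s).
Proof. by rewrite !inE. Qed.

Lemma big_seq_fset (K : numFieldType) (T : choiceType) (f : T -> K) (s : seq T) :
  uniq s -> \sum_(i <- [fset j in s]%fset) f i = \sum_(i <- s) f i.
Proof.
move=> us; apply: perm_big; apply: uniq_perm; rewrite ?fset_uniq// => i.
by rewrite in_seq_fset.
Qed.

(** * Geometric convergence and infinite products *)

(* The topology of [R[i]] comes only from its [numFieldType] structure, for which
   completeness has to be a hypothesis. *)
Definition geom_complete (K : numFieldType) :=
  forall (u : nat -> K) (C r : K), 0 <= r < 1 ->
    (forall n, `|u n.+1 - u n| <= C * r ^+ n) -> cvg (u @ \oo).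

(** [K] need not be archimedean, so convergence itself is drawn from [geom_complete], the increments
    being at most [r ^+ n]. The limit [l] satisfies [l = r * l]. *)
Lemma expr_cvg0 (K : numFieldType) (r : K) :
  geom_complete K -> 0 <= r < 1 -> r ^+ n @[n --> \oo] --> 0.
Proof.
move=> hK hr; have /andP[r0 r1] := hr.
have cu : cvg (r ^+ n @[n --> \oo]).
  apply: (hK _ 1 r hr) => n.
  have -> : r ^+ n.+1 - r ^+ n = - ((1 - r) * r ^+ n) by rewrite exprS; ring.
  rewrite normrN ger0_norm ?mulr_ge0 ?subr_ge0 ?exprn_ge0 ?(ltW r1)//.
  by rewrite ler_wpM2r ?exprn_ge0// gerBl.
set l := lim (r ^+ n @[n --> \oo]) in cu.
have h1 : r ^+ n.+1 @[n --> \oo] --> l by rewrite (cvg_shiftS (fun n => r ^+ n)).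
have h2 : r ^+ n.+1 @[n --> \oo] --> r * l.
  by under eq_fun do rewrite exprS; exact: (cvgM (cvg_cst r) cu).
have /eqP : l = r * l by apply: (cvg_unique (@norm_hausdorff K K) h1 h2).
rewrite -subr_eq0 -{1}[l]mul1r -mulrBl mulf_eq0 subr_eq0 gt_eqF//= => /eqP l0.
by move: cu; rewrite l0.
Qed.

Lemma sum_geom_le (K : numFieldType) (r : K) (n : nat) (E : {fset nat}) :
  0 <= r < 1 -> (forall i, i \in E -> (n <= i)%N) ->
  \sum_(i <- E) r ^+ i <= r ^+ n / (1 - r).
Proof.
move=> /andP[r0 r1] hE; have r1' : 0 < 1 - r by rewrite subr_gt0.
pose N := (\max_(i <- E) i).+1.
have sE : (E `<=` [fset i in iota n N])%fset.
  apply/fsubsetP => i iE; rewrite in_seq_fset mem_iota hE//=.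
  rewrite ltn_addl// ltnS; exact: (@leq_bigmax_seq _ (enum_fset E) xpredT id i iE isT).
apply: le_trans (ler_sum_fset _ sE) _ => [i|]; first exact: exprn_ge0.
rewrite big_seq_fset ?iota_uniq//.
rewrite ler_pdivlMr// mulrC.
suff -> : (1 - r) * \sum_(i <- iota n N) r ^+ i = r ^+ n - r ^+ (n + N).
  by rewrite gerBl exprn_ge0.
elim: N {sE} n {hE} => [|N IH] n; first by rewrite big_nil addn0; ring.
by rewrite big_cons mulrDr IH addSnnS exprS; ring.
Qed.

Lemma eps_geom (K : numFieldType) (r C e : K) :
  geom_complete K -> 0 <= r < 1 -> 0 <= C -> 0 < e ->
  \forall n \near \oo, C * (r ^+ n / (1 - r)) < e.
Proof.
move=> hK hr C0 e0; have /andP[r0 r1] := hr.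
have r1' : 0 < 1 - r by rewrite subr_gt0.
have c : C * (r ^+ n / (1 - r)) @[n --> \oo] --> C * (0 / (1 - r)).
  exact: (cvgM (cvg_cst C) (cvgM (expr_cvg0 hK hr) (cvg_cst (1 - r)^-1))).
rewrite mul0r mulr0 in c; have /cvgrPdist_lt /(_ _ e0) := c.
apply: filterS => n; rewrite sub0r normrN ger0_norm//.
by rewrite mulr_ge0// divr_ge0 ?exprn_ge0// ltW.
Qed.

(** The bridge from the one-sided limits in [theta] to unordered sums: the terms beyond the first
    [n] contribute at most [C * (r ^+ n / (1 - r))], whichever finite set they are taken from. *)
Lemma hasum_nat (K : numFieldType) (u : nat -> K) (C r : K) :
  geom_complete K -> 0 <= r < 1 -> (forall k, `|u k| <= C * r ^+ k) ->
  hasum u (lim (series u @ \oo)).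
Proof.
move=> hK hr hu; have /andP[r0 r1] := hr.
have r1' : 0 < 1 - r by rewrite subr_gt0.
have C0 : 0 <= C by have := hu 0%N; rewrite expr0 mulr1; apply: le_trans.
have cu : cvg (series u @ \oo).
  apply: (hK _ C r hr) => n; rewrite /series/= big_nat_recr//= [X in X - _]addrC.
  by rewrite addrK.
apply/hasumP => e e0; have e2 : 0 < e / 2 by rewrite divr_gt0.
have /cvgrPdist_lt /(_ _ e2) h1 := cu.
have [n [{}h1 h2]] : exists n, `|lim (series u @ \oo) - series u n| < e / 2 /\
    C * (r ^+ n / (1 - r)) < e / 2.
  have [N _ hN] := filterI h1 (eps_geom hK hr C0 e2).
  by exists N; have := hN N (leqnn N).
exists [fset i in iota 0 n]%fset => E sE.
have sn (f : nat -> K) : \sum_(i <- [fset i in iota 0 n]%fset) f i = series f n.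
  by rewrite /series/= /index_iota subn0 big_seq_fset ?iota_uniq.
have -> : e = e / 2 + e / 2 by field.
apply: (le_lt_trans (ler_distD (series u n) _ _)); apply: ltrD => //.
rewrite -sn distrC; apply: (le_lt_trans (dist_sum_fset _ sE)).
rewrite (big_fset_sub _ sE) addrC addKr; apply: le_lt_trans h2.
apply: le_trans (ler_sum _ (fun i _ => hu i)) _.
rewrite -mulr_sumr ler_wpM2l// big_fset_condE; apply: sum_geom_le => // i.
by rewrite !inE mem_iota/= -leqNgt => /andP[].
Qed.

(** The usual bound by the exponential of a sum has no meaning in a general [K]. Instead, [J] is
    chosen so that finite sums of the [b j] with [j >= J] stay below 1/2. The product of the
    [1 + b j], times 1 minus the sum of the [b j], never exceeds 1, so the factors from [J] on
    multiply to at most 2. *)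
Lemma prod_bounded (K : numFieldType) (a : nat -> K) (C r : K) :
  geom_complete K -> 0 <= r < 1 -> 0 <= C ->
  (forall j, `|a j| <= 1 + C * r ^+ j) ->
  exists2 M, 0 < M & forall n, `|\prod_(0 <= j < n) a j| <= M.
Proof.
move=> hK hr C0 ha; have /andP[r0 r1] := hr.
have r1' : 0 < 1 - r by rewrite subr_gt0.
have h2 : 0 < 2^-1 :> K by rewrite invr_gt0.
have [J _ /(_ J (leqnn J)) /= hJ] := eps_geom hK hr C0 h2.
pose b j := C * r ^+ j.
have b0 j : 0 <= b j by rewrite mulr_ge0 ?exprn_ge0.
pose P m n := \prod_(m <= j < n) (1 + b j).
have P0 m n : 0 <= P m n by apply: prodr_ge0 => j _; rewrite addr_ge0.
have tail n : P J (J + n)%N <= 2.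
  have h : P J (J + n)%N * (1 - \sum_(J <= j < J + n) b j) <= 1.
    elim: n => [|n IH].
      by rewrite addn0 /P !big_geq// subr0 mulr1.
    rewrite addnS /P !big_nat_recr ?leq_addr//= -/(P _ _).
    apply: le_trans IH; set S := \sum_(_ <= _ < _) _; set c := b _.
    rewrite -subr_ge0.
    have -> : P J (J + n)%N * (1 - S) - P J (J + n)%N * (1 + c) * (1 - (S + c)) =
      P J (J + n)%N * (c * (S + c)) by ring.
    by rewrite mulr_ge0// mulr_ge0 ?b0// addr_ge0 ?b0// sumr_ge0.
  have hS : \sum_(J <= j < J + n) b j <= 2^-1.
    apply: le_trans (ltW hJ); rewrite -mulr_sumr ler_wpM2l//.
    rewrite -big_seq_fset ?iota_uniq//; apply: sum_geom_le => // i.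
    by rewrite in_seq_fset mem_index_iota => /andP[].
  have : P J (J + n)%N / 2 <= 1.
    apply: le_trans h; rewrite ler_wpM2l// lerBrDr.
    have h1 : 1 = 2^-1 + 2^-1 :> K by field.
    by rewrite [leRHS]h1 lerD2l.
  by rewrite ler_pdivrMr// mul1r.
exists (P 0%N J * 2) => [|n].
  rewrite mulr_gt0//; apply: prodr_gt0 => j _.
  by rewrite ltr_pwDl.
apply: (@le_trans _ _ (P 0%N n)).
  by rewrite normr_prod; apply: ler_prod => j _; rewrite normr_ge0 ha.
apply: (@le_trans _ _ (P 0%N (J + n)%N)).
  rewrite {2}/P (@big_cat_nat _ _ _ n)/= ?leq_addl// -/(P _ _) ler_peMr//.
  elim/big_ind: _ => // [x y hx hy|j _]; first by rewrite -[1]mulr1 ler_pM.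
  by rewrite lerDl.
rewrite {1}/P (@big_cat_nat _ _ _ J)/= ?leq_addr// -/(P _ _) -/(P _ _).
by rewrite ler_wpM2l.
Qed.

Lemma qpoch_cvg (K : numFieldType) (a p : K) : geom_complete K -> `|p| < 1 ->
  \prod_(0 <= j < m) (1 - a * p ^+ j) @[m --> \oo] --> qpoch a p.
Proof.
move=> hK p1; have hp : 0 <= `|p| < 1 by rewrite normr_ge0.
have [M M0 hM] : exists2 M, 0 < M &
    forall n, `|\prod_(0 <= j < n) (1 - a * p ^+ j)| <= M.
  apply: (@prod_bounded _ _ `|a| `|p|) => // j.
  by apply: le_trans (ler_normB _ _) _; rewrite normr1 normrM normrX.
apply: (hK _ (M * `|a|) `|p| hp) => n; rewrite big_nat_recr//=.
set P := \prod_(_ <= _ < _) _.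
have -> : P * (1 - a * p ^+ n) - P = - (P * (a * p ^+ n)) by ring.
by rewrite normrN !normrM normrX -mulrA ler_pM ?hM ?mulr_ge0 ?exprn_ge0.
Qed.

Lemma subr1_neq0_norm (K : numFieldType) (x : K) : `|x| < 1 -> 1 - x != 0.
Proof.
by move=> x1; rewrite subr_eq0; apply: contraTneq x1 => <-; rewrite normr1 ltxx.
Qed.

(** Rests on [1 / |1 - x| <= 1 / (1 - |x|) = 1 + |x| / (1 - |x|)] for [x = p * p ^+ j]. The bound
    serves twice: it keeps [qpoch p p] away from 0 and it dominates the q-binomial coefficients. *)
Lemma qpoch_inv_bounded (K : numFieldType) (p : K) :
  geom_complete K -> `|p| < 1 ->
  exists2 M, 0 < M & forall n, `|(\prod_(0 <= j < n) (1 - p * p ^+ j))^-1| <= M.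
Proof.
move=> hK p1; have hp : 0 <= `|p| < 1 by rewrite normr_ge0.
have p1' : 0 < 1 - `|p| by rewrite subr_gt0.
have C0 : 0 <= (1 - `|p|)^-1 by rewrite invr_ge0 ltW.
have [|M M0 hM] := @prod_bounded _ (fun j => (1 - p * p ^+ j)^-1) _ `|p| hK hp C0.
  move=> j; rewrite normfV.
  set x := p * p ^+ j; have hx : `|x| <= `|p|.
    by rewrite normrM ler_piMr// normrX exprn_ile1// ltW.
  have hx' : `|x| <= `|p| ^+ j.
    by rewrite normrM normrX ler_piMl ?exprn_ge0// ltW.
  have h0 : 0 < 1 - `|x| by rewrite subr_gt0; apply: le_lt_trans p1.
  apply: (@le_trans _ _ (1 - `|x|)^-1).
    rewrite lef_pV2 ?posrE//; first by have := lerB_dist 1 x; rewrite normr1.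
    by rewrite normr_gt0 subr1_neq0_norm// (le_lt_trans hx).
  have -> : (1 - `|x|)^-1 = 1 + (1 - `|x|)^-1 * `|x| by field; rewrite gt_eqF.
  rewrite lerD2l ler_pM ?invr_ge0 ?(ltW h0)//.
  by rewrite lef_pV2 ?posrE// lerB.
by exists M => // n; rewrite -prodfV.
Qed.

Lemma qpoch_neq0 (K : numFieldType) (p : K) :
  geom_complete K -> `|p| < 1 -> qpoch p p != 0.
Proof.
move=> hK p1; have [M M0 hM] := qpoch_inv_bounded hK p1.
apply/eqP => h0; have := @qpoch_cvg _ p p hK p1; rewrite h0.
move=> /cvgrPdist_lt /(_ M^-1); rewrite invr_gt0 => /(_ M0) [n _ /(_ n (leqnn n))] /=.
set P := \prod_(_ <= _ < _) _; rewrite sub0r normrN => hP.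
have P0 : P != 0.
  rewrite prodf_seq_neq0; apply/allP => j _ /=; apply: subr1_neq0_norm.
  by rewrite -exprS normrX exprn_ilt1.
have := hM n; rewrite -/P normfV invf_ple ?posrE ?normr_gt0// => /le_lt_trans /(_ hP).
by rewrite ltxx.
Qed.

(** * Theta series *)

Definition tri (j : int) : int := ((j * (j - 1)) %/ 2)%Z.

Lemma triS (j : int) : tri (j + 1) = tri j + j.
Proof. by rewrite /tri; lia. Qed.

(** Trades the integer division for a polynomial equation, the form in which the exponent identities
    below use [tri]. *)
Lemma tri_mul2 (j : int) : 2 * tri j = j * (j - 1).
Proof.
elim/int_ind: j => [//|n IH|n IH].
  have := triS n%:Z; have -> : n%:Z + 1 = n.+1%:Z by lia.
  by move: IH; lia.
have := triS (- n.+1%:Z); have -> : - n.+1%:Z + 1 = - n%:Z by lia.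
by move: IH; lia.
Qed.

Lemma theta_termE (K : numFieldType) (a b : K) (j : int) :
  a != 0 -> theta_term a b j = (a * b) ^ tri j * a ^ j.
Proof.
move=> a0; rewrite /theta_term.
have -> : ((j * (j + 1)) %/ 2)%Z = tri j + j by rewrite -triS /tri addrK mulrC.
by rewrite expfzDr// expfzMl -/(tri j); ring.
Qed.

Lemma theta_termS (K : numFieldType) (a b : K) (j : int) : a != 0 -> b != 0 ->
  theta_term a b (j + 1) = theta_term a b j * a * (a * b) ^ j.
Proof.
move=> a0 b0; rewrite !theta_termE// triS !expfzDr ?mulf_neq0//.
by rewrite expr1z; ring.
Qed.

Lemma normr_exprz (K : numFieldType) (x : K) (n : int) : `|x ^ n| = `|x| ^ n.
Proof. by case: n => n; rewrite ?NegzE -?exprnN -?exprnP ?normfV normrX. Qed.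

Lemma norm_theta_term (K : numFieldType) (a b : K) (j : int) :
  `|theta_term a b j| = theta_term `|a| `|b| j.
Proof. by rewrite /theta_term normrM !normr_exprz. Qed.

(** With both norms below 1, and not only that of [a * b], each half is geometrically dominated from
    its first term: the exponent of [a] at [k] is at least [k], and that of [b] at [- k.+1] is at
    least [k.+1]. *)
Lemma hasum_theta (K : numFieldType) (a b : K) : geom_complete K ->
  `|a| < 1 -> `|b| < 1 -> hasum (theta_term a b) (theta a b).
Proof.
move=> hK a1 b1.
have ha : 0 <= `|a| < 1 by rewrite normr_ge0.
have hb : 0 <= `|b| < 1 by rewrite normr_ge0.
have expz_le (x : K) (k l : nat) : `|x| < 1 -> (k <= l)%N -> `|x ^+ l| <= `|x| ^+ k.
  by move=> x1 kl; rewrite normrX ler_wiXn2l// ltW.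
have hp : forall k : nat, `|theta_term a b k%:Z| <= 1 * `|a| ^+ k.
  move=> k; rewrite mul1r /theta_term normrM.
  have -> : ((k%:Z * (k%:Z + 1)) %/ 2)%Z = (tri (k%:Z + 1)) by rewrite /tri addrK mulrC.
  have h : 0 <= tri k%:Z by rewrite /tri; nia.
  rewrite triS -/(tri _); move: h; case: (tri _) => // t _.
  by rewrite -PoszD -!exprnP -[leRHS]mulr1 ler_pM// ?expz_le ?leq_addl//
     -(expr0 `|b|) expz_le.
have hn : forall k : nat, `|theta_term a b (- k.+1%:Z)| <= `|b| * `|b| ^+ k.
  move=> k; rewrite -exprS /theta_term normrM.
  have -> : ((- k.+1%:Z * (- k.+1%:Z + 1)) %/ 2)%Z = tri k.+1%:Z.
    by rewrite /tri; congr (_ %/ _)%Z; ring.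
  have -> : ((- k.+1%:Z * (- k.+1%:Z - 1)) %/ 2)%Z = tri (k.+1%:Z + 1).
    by rewrite /tri; congr (_ %/ _)%Z; ring.
  have h : 0 <= tri k.+1%:Z by rewrite /tri; nia.
  rewrite triS; move: h; case: (tri _) => // t _.
  by rewrite -PoszD -!exprnP -[leRHS]mul1r ler_pM// ?expz_le ?leq_addl//
     -(expr0 `|a|) expz_le.
have Hp := hasum_nat hK ha hp; have Hn := hasum_nat hK hb hn.
pose fp (j : int) := if 0 <= j then theta_term a b j else 0.
pose fn (j : int) := if 0 <= j then 0 else theta_term a b j.
have hfp : hasum fp (lim (series (fun k : nat => theta_term a b k%:Z) @ \oo)).
  apply: (@hasum_inj _ _ _ Posz absz) => // j; rewrite /fp.
  by case: ifP => // j0; rewrite gez0_abs// eqxx.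
have hfn : hasum fn (lim (series (fun k : nat => theta_term a b (- k.+1%:Z)) @ \oo)).
  apply: (@hasum_inj _ _ _ Negz (fun j => `|j|.-1)%N) => //; rewrite /fn => -[]//= n.
  by rewrite eqxx.
apply: eq_hasum (hasumD hfp hfn) => j; rewrite /fp /fn.
by case: ifP; rewrite ?addr0 ?add0r.
Qed.

Lemma hasum_norm_theta (K : numFieldType) (a b : K) : geom_complete K ->
  `|a| < 1 -> `|b| < 1 ->
  hasum (fun j => `|theta_term a b j|) (theta `|a| `|b|).
Proof.
move=> hK a1 b1; apply: (@eq_hasum _ _ (theta_term `|a| `|b|)) => [j|].
  by rewrite norm_theta_term.
by apply: hasum_theta; rewrite ?normr_id.
Qed.

(** * The Jacobi triple product *)

(** Dominated convergence with limit 0, so that the finite sets [S m] may be arbitrary. The terms in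
    a fixed [E0] die out; the norms of the others are bounded by a difference of two partial sums of
    [w], both within [e / 3] of [l]. *)
Lemma tannery (K : numFieldType) (T : choiceType) (f : nat -> T -> K) (w : T -> K)
    (l : K) (S : nat -> {fset T}) :
  hasum w l -> (forall m t, `|f m t| <= w t) ->
  (forall t, f m t @[m --> \oo] --> 0) ->
  \sum_(t <- S m) f m t @[m --> \oo] --> 0.
Proof.
move=> /hasumP hw fw f0; apply/cvgrPdist_lt => e e0.
have e3 : 0 < e / 3 by rewrite divr_gt0.
have [E0 hE0] := hw _ e3.
have /cvgrPdist_lt /(_ _ e3) : \sum_(t <- E0) `|f m t| @[m --> \oo] --> \sum_(t <- E0) (0 : K).
  apply: cvg_big => [|t _]; first exact: add_continuous.
  by rewrite -(normr0 K); apply: cvg_norm.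
apply: filterS => m; rewrite big1// !sub0r !normrN ger0_norm ?sumr_ge0// => h1.
apply: le_lt_trans (ler_norm_sum _ _ _) _.
apply: (@le_lt_trans _ _ (\sum_(t <- (E0 `|` S m)%fset) `|f m t|)).
  by apply: ler_sum_fset => //; apply: fsubsetUr.
have -> : e = e / 3 + (e / 3 + e / 3) by field.
have s0 := fsubsetUl E0 (S m).
rewrite (big_fset_sub _ s0) ltrD//.
apply: le_lt_trans (ler_sum _ (fun t _ => fw m t)) _.
have -> : \sum_(t <- (E0 `|` S m)%fset | t \notin E0) w t =
    \sum_(t <- (E0 `|` S m)%fset) w t - \sum_(t <- E0) w t.
  by rewrite (big_fset_sub w s0) addrC addKr.
have w0 t : 0 <= w t by apply: le_trans (fw 0%N t).
rewrite -[X in X < _]ger0_norm ?subr_ge0 ?ler_sum_fset//.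
apply: le_lt_trans (ler_distD l _ _) _; rewrite [X in X + _]distrC.
by apply: ltrD; apply: hE0.
Qed.

(** The symbol $(p;p)_n$, with factors written so that it is literally a partial product of
    [qpoch p p]. *)
Definition qfact (K : numFieldType) (p : K) (n : nat) : K :=
  \prod_(0 <= j < n) (1 - p * p ^+ j).

(** The value 0 beyond [n] lets both q-Pascal rules hold at the end index [i = n]. *)
Definition qbinom (K : numFieldType) (p : K) (n i : nat) : K :=
  if (i <= n)%N then qfact p n / (qfact p i * qfact p (n - i)) else 0.

Lemma qfactS (K : numFieldType) (p : K) (n : nat) :
  qfact p n.+1 = qfact p n * (1 - p ^+ n.+1).
Proof. by rewrite /qfact big_nat_recr//= exprS. Qed.

Lemma qfact_neq0 (K : numFieldType) (p : K) (n : nat) : `|p| < 1 -> qfact p n != 0.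
Proof.
move=> p1; rewrite prodf_seq_neq0; apply/allP => j _ /=; apply: subr1_neq0_norm.
by rewrite -exprS normrX exprn_ilt1.
Qed.

Lemma qbinom0 (K : numFieldType) (p : K) (n : nat) :
  `|p| < 1 -> qbinom p n 0 = 1.
Proof.
move=> p1; rewrite /qbinom subn0 {2}/qfact big_geq// mul1r divff//.
exact: qfact_neq0.
Qed.

Lemma qbinom_small (K : numFieldType) (p : K) (n i : nat) :
  (n < i)%N -> qbinom p n i = 0.
Proof. by move=> lt_ni; rewrite /qbinom leqNgt lt_ni. Qed.

Lemma qbinomnn (K : numFieldType) (p : K) (n : nat) :
  `|p| < 1 -> qbinom p n n = 1.
Proof.
move=> p1; rewrite /qbinom leqnn subnn {3}/qfact big_geq// mulr1 divff//.
exact: qfact_neq0.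
Qed.

Lemma qbinomS (K : numFieldType) (p : K) (n i : nat) : `|p| < 1 -> (i <= n)%N ->
  qbinom p n.+1 i.+1 = qbinom p n i.+1 + p ^+ (n - i) * qbinom p n i.
Proof.
move=> p1; rewrite leq_eqVlt => /orP[/eqP -> |lt_in].
  by rewrite subnn !qbinomnn// qbinom_small// mul1r add0r.
rewrite /qbinom ltnS (ltnW lt_in) lt_in subSS.
have [j ->] : exists j, n = (i + j).+1.
  by exists (n - i.+1)%N; rewrite -addSn subnKC.
rewrite -addnS addKn; have := qfact_neq0 i.+1 p1; have := qfact_neq0 j.+1 p1.
have -> : (i + j.+1 - i.+1)%N = j by rewrite addnS subSS addKn.
rewrite !qfactS !mulf_eq0 !negb_or => /andP[h1 h2] /andP[h3 h4].
have -> : p ^+ (i + j.+1).+1 = p ^+ j.+1 * p ^+ i.+1.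
  by rewrite -exprD; congr (_ ^+ _); lia.
by field; rewrite h1 h2 h3 h4.
Qed.

(** The second q-Pascal rule. The first serves to add a factor on the [y] side of the finite
    product, this one on the [z] side. *)
Lemma qbinomS' (K : numFieldType) (p : K) (n i : nat) : `|p| < 1 -> (i <= n)%N ->
  qbinom p n.+1 i.+1 = p ^+ i.+1 * qbinom p n i.+1 + qbinom p n i.
Proof.
move=> p1; rewrite leq_eqVlt => /orP[/eqP -> |lt_in].
  by rewrite !qbinomnn// qbinom_small// mulr0 add0r.
rewrite /qbinom ltnS (ltnW lt_in) lt_in subSS.
have [j ->] : exists j, n = (i + j).+1.
  by exists (n - i.+1)%N; rewrite -addSn subnKC.
rewrite -addnS addKn; have := qfact_neq0 i.+1 p1; have := qfact_neq0 j.+1 p1.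
have -> : (i + j.+1 - i.+1)%N = j by rewrite addnS subSS addKn.
rewrite !qfactS !mulf_eq0 !negb_or => /andP[h1 h2] /andP[h3 h4].
have -> : p ^+ (i + j.+1).+1 = p ^+ j.+1 * p ^+ i.+1.
  by rewrite -exprD; congr (_ ^+ _); lia.
by field; rewrite h1 h2 h3 h4.
Qed.

(** Rothe's q-binomial theorem: with [p = y * z], the theta term at [i] is $p^{i(i-1)/2}(-y)^i$. *)
Lemma finite_jtp_left (K : numFieldType) (y z : K) (m : nat) :
  y != 0 -> z != 0 -> `|y * z| < 1 ->
  \prod_(0 <= j < m) (1 - y * (y * z) ^+ j) =
  \sum_(0 <= i < m.+1) qbinom (y * z) m i * theta_term (- y) (- z) i%:Z.
Proof.
move=> y0 z0 p1; have ny0 : - y != 0 by rewrite oppr_eq0.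
have nz0 : - z != 0 by rewrite oppr_eq0.
elim: m => [|m IH].
  by rewrite big_geq// big_nat1 qbinom0// theta_termE// mul1r !expr0z mulr1.
set p := y * z in p1 IH *; pose T (i : nat) := theta_term (- y) (- z) i%:Z.
have TS i : T i.+1 = - (T i * y * p ^+ i).
  by rewrite /T -addn1 PoszD theta_termS// mulrNN -/p -exprnP; ring.
rewrite big_nat_recr//= {}IH [RHS]big_nat_recl// qbinom0//.
rewrite [X in _ = _ + X](eq_big_nat _ _ (F2 := fun i => qbinom p m i.+1 * T i.+1 +
    - (y * p ^+ m) * (qbinom p m i * T i))); last first.
  move=> i /andP[_]; rewrite ltnS => le_im; rewrite qbinomS// mulrDl; congr (_ + _).
  have -> : p ^+ m = p ^+ (m - i) * p ^+ i by rewrite -exprD subnK.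
  by rewrite -/(T i.+1) TS; ring.
rewrite big_split/= -mulr_sumr addrA.
have -> : 1 * theta_term (- y) (- z) 0 +
    \sum_(0 <= i < m.+1) qbinom p m i.+1 * T i.+1 =
    \sum_(0 <= i < m.+1) qbinom p m i * T i.
  rewrite -(qbinom0 m p1) -[theta_term _ _ _]/(T 0%N).
  rewrite -(big_nat_recl _ _ (fun i => qbinom p m i * T i))//.
  by rewrite big_nat_recr//= qbinom_small// mul0r addr0.
by rewrite /T; ring.
Qed.

(* [r = m] is the finite form of the Jacobi triple product. *)
Lemma finite_jtp (K : numFieldType) (y z : K) (m r : nat) :
  y != 0 -> z != 0 -> `|y * z| < 1 ->
  \prod_(0 <= j < m) (1 - y * (y * z) ^+ j) *
  \prod_(0 <= j < r) (1 - z * (y * z) ^+ j) =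
  \sum_(0 <= i < (m + r).+1)
    qbinom (y * z) (m + r) i * theta_term (- y) (- z) (i%:Z - r%:Z).
Proof.
move=> y0 z0 p1; have ny0 : - y != 0 by rewrite oppr_eq0.
have nz0 : - z != 0 by rewrite oppr_eq0.
have p0 : y * z != 0 by rewrite mulf_neq0.
(* Keeping [m] and [r] independent allows one [z] factor to be added at a time, starting from
   Rothe's theorem. *)
elim: r => [|r IH].
  rewrite [X in _ * X]big_geq// mulr1 addn0 finite_jtp_left//.
  by under [RHS]eq_bigr do rewrite subr0.
rewrite [X in _ * X]big_nat_recr//= mulrA {}IH addnS; set n := (m + r)%N.
set p := y * z in p1 p0 *; pose T (i : nat) := theta_term (- y) (- z) (i%:Z - r.+1%:Z).
(* Multiplying by [z * p ^+ r] moves a term back by one index and leaves a power of [p], the one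
   carried by the first summand of [qbinomS'] after a shift. *)
have TS i : z * p ^+ r * T i.+1 = - (p ^+ i * T i).
  rewrite /T; have -> : i.+1%:Z - r.+1%:Z = (i%:Z - r.+1%:Z) + 1 by lia.
  rewrite theta_termS// mulrNN -/p.
  have -> : p ^+ i = p ^+ r * p ^ (i%:Z - r.+1%:Z) * p.
    rewrite !exprnP -expfzDr// -{3}[p]expr1z -expfzDr//; congr (_ ^ _); lia.
  by move: (p ^ _) (p ^+ r) => u v; rewrite /p; ring.
have TE i : theta_term (- y) (- z) (i%:Z - r%:Z) = T i.+1.
  by rewrite /T; congr theta_term; lia.
under [X in X * _ = _]eq_bigr do rewrite TE.
rewrite [RHS]big_nat_recl// qbinom0// -/(T 0%N).
rewrite [X in _ = _ + X](eq_big_nat _ _ (F2 := fun i => p ^+ i.+1 * qbinom p n i.+1 * T i.+1 +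
    qbinom p n i * T i.+1)); last first.
  by move=> i /andP[_]; rewrite ltnS => le_in; rewrite qbinomS'// mulrDl.
rewrite big_split/= addrA.
have -> : 1 * T 0%N + \sum_(0 <= i < n.+1) p ^+ i.+1 * qbinom p n i.+1 * T i.+1 =
    \sum_(0 <= i < n.+1) p ^+ i * qbinom p n i * T i.
  rewrite -(qbinom0 n p1) -[qbinom p n 0]mul1r -[X in X * qbinom _ _ _](expr0 p).
  rewrite -(big_nat_recl _ _ (fun i => p ^+ i * qbinom p n i * T i))//.
  by rewrite big_nat_recr//= qbinom_small// mulr0 mul0r addr0.
rewrite mulrBr mulr1 [RHS]addrC mulr_suml; congr (_ + _).
rewrite -sumrN; apply: eq_bigr => i _.
have -> : qbinom p n i * T i.+1 * (z * p ^+ r) =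
  qbinom p n i * (z * p ^+ r * T i.+1) by ring.
by rewrite TS; ring.
Qed.

Lemma qfact_cvg (K : numFieldType) (p : K) : geom_complete K -> `|p| < 1 ->
  qfact p n @[n --> \oo] --> qpoch p p.
Proof. exact: qpoch_cvg. Qed.

(** These sets are the integers from [-m] to [m], enumerated as in [finite_jtp] with [r = m]. *)
Lemma cvg_int_interval :
  [fset (i%:Z - m%:Z)%R | i in iota 0 (m + m).+1]%fset @[m --> \oo] -->
  (@totally int).
Proof.
have in_range (k : int) (m : nat) : (absz k <= m)%N ->
    exists2 i, i \in iota 0 (m + m).+1 & k = i%:Z - m%:Z.
  by move=> hk; exists (absz (k + m%:Z)%R); rewrite ?mem_iota; lia.
move=> P [F _ hF]; exists (\max_(k <- F) `|k|)%N => // m /= hm.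
apply: hF => /=; apply/fsubsetP => k kF; apply/imfsetP => /=; apply: in_range.
apply: leq_trans hm.
exact: (@leq_bigmax_seq _ (enum_fset F) xpredT absz k kF isT).
Qed.

Lemma jacobi_triple_product (K : numFieldType) (y z : K) : geom_complete K ->
  y != 0 -> z != 0 -> `|y| < 1 -> `|z| < 1 ->
  theta (- y) (- z) = qpoch (y * z) (y * z) * qpoch2 y z (y * z).
Proof.
move=> hK y0 z0 y1 z1; set p := y * z.
have p1 : `|p| < 1 by rewrite normrM mulr_ilt1.
have hp : 0 <= `|p| < 1 by rewrite normr_ge0.
have c0 := qpoch_neq0 hK p1; set c := qpoch p p in c0 *.
have ht : hasum (theta_term (- y) (- z)) (theta (- y) (- z)).
  by apply: hasum_theta; rewrite ?normrN.
have ht' : hasum (fun j => `|theta_term (- y) (- z) j|) (theta `|- y| `|- z|).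
  by apply: hasum_norm_theta; rewrite ?normrN.
set t := theta_term _ _ in ht ht'.
have qc : qfact p n @[n --> \oo] --> c by apply: qfact_cvg.
have [M1 M10 hM1] : exists2 M, 0 < M & forall n, `|qfact p n| <= M.
  apply: (@prod_bounded _ _ `|p| `|p|) => // j.
  by apply: le_trans (ler_normB _ _) _; rewrite normr1 normrM normrX.
have [M2 M20 hM2] := qpoch_inv_bounded hK p1.
(* For [|k| <= m] this is the q-binomial coefficient of [m + m] over [k + m]. The absolute values
   extend it to every [k], so that the uniform bound and the limit [c / (c * c)] can be stated for
   all [k]. *)
pose d m (k : int) := qfact p (m + m) / (qfact p (absz (k + m%:Z)%R) * qfact p (absz (m%:Z - k)%R)).
pose M := M1 * (M2 * M2) + `|c^-1|.
pose S m := [fset (i%:Z - m%:Z)%R | i in iota 0 (m + m).+1]%fset.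
have dist_cvg (f : nat -> nat) : (forall N, \forall m \near \oo, (N <= f m)%N) ->
    qfact p (f m) @[m --> \oo] --> c.
  by move=> hf; apply: (cvg_comp f (qfact p)) qc; apply/cvgnyPge.
have hd k : d m k @[m --> \oo] --> c^-1.
  have -> : c^-1 = c / (c * c) by field.
  apply: cvgM.
    by apply: (dist_cvg (fun m => m + m)%N) => N; exists N => //= m /= hm; lia.
  apply: (@cvgV _ _ _ _ (fun m => qfact p (absz (k + m%:Z)%R) * qfact p (absz (m%:Z - k)%R))).
    by rewrite mulf_neq0.
  apply: cvgM.
    by apply: (dist_cvg (fun m => absz (k + m%:Z)%R)) => N;
      exists (N + absz k)%N => //= m /= hm; lia.
  by apply: (dist_cvg (fun m => absz (m%:Z - k)%R)) => N;
    exists (N + absz k)%N => //= m /= hm; lia.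
have h0 : \sum_(k <- S m) (d m k - c^-1) * t k @[m --> \oo] --> 0.
  apply: (@tannery _ _ _ (fun k => M * `|t k|) (M * theta `|- y| `|- z|)).
  - exact: hasumZ.
  - move=> m k; rewrite normrM ler_wpM2r//.
    apply: le_trans (ler_normB _ _) _; rewrite lerD2r /d invfM !normrM.
    by rewrite !ler_pM ?mulr_ge0//; apply: hM2.
  - move=> k; rewrite -(mul0r (t k)) -(subrr c^-1).
    by apply: cvgM; [apply: cvgB => //; apply: cvg_cst|apply: cvg_cst].
have h1 : \sum_(k <- S m) t k @[m --> \oo] --> theta (- y) (- z).
  exact: (cvg_comp _ _ cvg_int_interval ht).
have h2 : \sum_(k <- S m) d m k * t k @[m --> \oo] --> c^-1 * theta (- y) (- z).
  have e m : \sum_(k <- S m) d m k * t k =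
      \sum_(k <- S m) (d m k - c^-1) * t k + c^-1 * \sum_(k <- S m) t k.
    rewrite mulr_sumr -big_split/=; apply: eq_bigr => k _.
    by rewrite mulrBl subrK.
  under eq_fun do rewrite e.
  have := cvgD h0 (cvgM (cvg_cst c^-1) h1); rewrite add0r; exact.
have h3 : \sum_(k <- S m) d m k * t k @[m --> \oo] --> qpoch2 y z p.
  have e m : \sum_(k <- S m) d m k * t k =
      \prod_(0 <= j < m) (1 - y * p ^+ j) * \prod_(0 <= j < m) (1 - z * p ^+ j).
    have us : undup (iota 0 (m + m).+1) = iota 0 (m + m).+1.
      by rewrite undup_id ?iota_uniq.
    rewrite finite_jtp// /S big_imfset; last by move=> i j _ _ /=; lia.
    rewrite [X in \sum_(_ <- X) _ = _]us /index_iota subn0.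
    apply: eq_big_seq => i; rewrite mem_iota add0n ltnS => /andP[_ hi].
    rewrite /qbinom hi /d -/p.
    have -> : absz (i%:Z - m%:Z + m%:Z)%R = i by rewrite subrK.
    by have -> : absz (m%:Z - (i%:Z - m%:Z))%R = (m + m - i)%N by lia.
  under eq_fun do rewrite e.
  exact: cvgM (@qpoch_cvg _ y p hK p1) (@qpoch_cvg _ z p hK p1).
rewrite -(cvg_unique (@norm_hausdorff K K) h2 h3).
by rewrite mulrA divff// mul1r.
Qed.

(** * Quadratic identities between theta series *)

Lemma sign_neq0 (K : numFieldType) (e : K) : e * e = 1 -> e != 0.
Proof. by apply: contra_eqN => /eqP ->; rewrite mul0r eq_sym oner_eq0. Qed.

(** The exponent of [Q] in the [j]-th term of [theta (e * Q ^+ u * x) (e * Q ^+ v / x)]. Every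
    series in the two quadratic identities has this shape, [phi] and [psi] with [x = 1]. *)
Definition qexp (u v : nat) (j : int) : int := (u%:Z + v%:Z) * tri j + u%:Z * j.

Lemma theta_term_monomial (K : numFieldType) (e Q x : K) (u v : nat) (j : int) :
  e * e = 1 -> Q != 0 -> x != 0 ->
  theta_term (e * Q ^+ u * x) (e * Q ^+ v / x) j =
  e ^ j * Q ^ qexp u v j * x ^ j.
Proof.
move=> ee Q0 x0; have e0 := sign_neq0 ee.
rewrite theta_termE ?mulf_neq0 ?expf_neq0//.
have -> : e * Q ^+ u * x * (e * Q ^+ v / x) = Q ^ (u%:Z + v%:Z).
  rewrite expfzDr// -!exprnP.
  have -> : e * Q ^+ u * x * (e * Q ^+ v / x) = (e * e) * (Q ^+ u * Q ^+ v) * (x / x).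
    by ring.
  by rewrite ee divff// mul1r mulr1.
rewrite /qexp exprz_exp !expfzMl [Q ^+ u]exprnP exprz_exp [in RHS]expfzDr//.
by ring.
Qed.

Lemma hasum_monomial (K : numFieldType) (e Q x a b : K) (u v : nat) :
  geom_complete K -> e * e = 1 -> Q != 0 -> x != 0 ->
  a = e * Q ^+ u * x -> b = e * Q ^+ v / x -> `|a| < 1 -> `|b| < 1 ->
  let f := fun j : int =>
    e ^ j * Q ^ qexp u v j * x ^ j in
  hasum f (theta a b) /\ hasum (fun j => `|f j|) (theta `|a| `|b|).
Proof.
move=> hK ee Q0 x0 ea eb a1 b1 f.
have -> : f = theta_term a b by apply/funext => j; rewrite ea eb theta_term_monomial.
by split; [apply: hasum_theta|apply: hasum_norm_theta].
Qed.

Lemma exprz_sign (K : numFieldType) (e : K) (m n k : int) :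
  e * e = 1 -> m = n + 2 * k -> e ^ m = e ^ n.
Proof.
move=> ee ->; have e0 := sign_neq0 ee.
rewrite expfzDr// -exprz_exp.
have -> : e ^ 2 = 1 by rewrite -exprnP expr2.
by rewrite exp1rz mulr1.
Qed.

(** Cuts out the image of [(i, j) |-> (i - j, i + j)]; the complement is the image of
    [(i, j) |-> (i - j, 1 - i - j)]. *)
Definition esum (p : int * int) : bool := ((p.1 + p.2) %% 2)%Z == 0.

Lemma rot_evenK : cancel (fun p : int * int => (p.1 - p.2, p.1 + p.2))
  (fun p => ((p.2 + p.1) %/ 2, (p.2 - p.1) %/ 2)%Z).
Proof. by move=> [i j] /=; congr (_, _); lia. Qed.

Lemma rot_even_range (p : int * int) : esum p ->
  (((p.2 + p.1) %/ 2)%Z - ((p.2 - p.1) %/ 2)%Z,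
   ((p.2 + p.1) %/ 2)%Z + ((p.2 - p.1) %/ 2)%Z) = p.
Proof. by case: p => d s; rewrite /esum /= => h; congr (_, _); lia. Qed.

(** The second coordinate is the exponent of [x] in [x * B ^ 2], whose series runs over powers of
    [x^-1]; hence [1 - i - j] instead of [1 + i + j]. *)
Lemma rot_oddK : cancel (fun p : int * int => (p.1 - p.2, 1 - p.1 - p.2))
  (fun p => ((1 - p.2 + p.1) %/ 2, (1 - p.2 - p.1) %/ 2)%Z).
Proof. by move=> [i j] /=; congr (_, _); lia. Qed.

Lemma rot_odd_range (p : int * int) : ~~ esum p ->
  (((1 - p.2 + p.1) %/ 2)%Z - ((1 - p.2 - p.1) %/ 2)%Z,
   1 - ((1 - p.2 + p.1) %/ 2)%Z - ((1 - p.2 - p.1) %/ 2)%Z) = p.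
Proof. by case: p => d s; rewrite /esum /= => h; congr (_, _); lia. Qed.

Lemma esum_even (i j : int) : esum (i - j, i + j).
Proof. by rewrite /esum/=; lia. Qed.

Lemma esum_odd (i j : int) : esum (i - j, 1 - i - j) = false.
Proof. by rewrite /esum/=; lia. Qed.

(** Here [qexp 1 1 d = d^2], [qexp 0 2 s = s^2 - s] and [qexp 1 3 i = 2 i^2 - i], so this is the
    parallelogram law. *)
Lemma qexp_even (i j : int) :
  qexp 1 1 (i - j) + qexp 0 2 (i + j) = qexp 1 3 i + qexp 1 3 j.
Proof.
rewrite /qexp; have h1 := tri_mul2 i; have h2 := tri_mul2 j.
have h3 := tri_mul2 (i + j); have h4 := tri_mul2 (i - j); lia.
Qed.

(** Follows the even case because [s^2 - s] is invariant under [s |-> 1 - s]. *)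
Lemma qexp_odd (i j : int) :
  qexp 1 1 (i - j) + qexp 0 2 (1 - i - j) = qexp 1 3 i + qexp 1 3 j.
Proof.
rewrite /qexp; have h1 := tri_mul2 i; have h2 := tri_mul2 j.
have h3 := tri_mul2 (1 - i - j); have h4 := tri_mul2 (i - j); lia.
Qed.

Lemma sign_even (K : numFieldType) (e : K) (i j : int) : e * e = 1 ->
  (- e) ^ (i - j) * e ^ (i + j) = (-1) ^ i * (-1) ^ j.
Proof.
move=> ee; have e0 := sign_neq0 ee.
rewrite -[- e]mulN1r expfzMl -mulrA -!expfzDr ?oppr_eq0 ?oner_eq0//.
rewrite (@exprz_sign _ e _ 0 i ee); last by ring.
rewrite expr0z mulr1; apply: (@exprz_sign _ _ _ _ (- j)); last by ring.
by rewrite mulrNN mulr1.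
Qed.

(** The exponents of [e] add up to [1 - 2j], which leaves one [e]: the sign in front of
    [x * B ^ 2]. *)
Lemma sign_odd (K : numFieldType) (e : K) (i j : int) : e * e = 1 ->
  (- e) ^ (i - j) * e ^ (1 - i - j) = e * ((-1) ^ i * (-1) ^ j).
Proof.
move=> ee; have e0 := sign_neq0 ee.
rewrite -[- e]mulN1r expfzMl -mulrA -!expfzDr ?oppr_eq0 ?oner_eq0//.
rewrite (@exprz_sign _ e _ 1 (- j) ee); last by ring.
rewrite expr1z mulrC; congr (_ * _).
apply: (@exprz_sign _ _ _ _ (- j)); last by ring.
by rewrite mulrNN mulr1.
Qed.

(** For each [d], enumerates the [s] of the same parity. Odd ones are written [1 - 2k] because
    [s^2 - s] is then [4 k^2 - 2k], as for [s = 2k]; this is the exponent of [Q] in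
    [psi (Q ^+ 2)]. *)
Definition fold_parity (p : int * int) : int * int :=
  (p.1, if (p.1 %% 2)%Z == 0 then 2 * p.2 else 1 - 2 * p.2).

Definition unfold_parity (p : int * int) : int * int :=
  (p.1, if (p.1 %% 2)%Z == 0 then (p.2 %/ 2)%Z else ((1 - p.2) %/ 2)%Z).

Lemma fold_parityK : cancel fold_parity unfold_parity.
Proof.
move=> [d k]; rewrite /fold_parity /unfold_parity /=.
by case: ((d %% 2)%Z == 0); congr (_, _); lia.
Qed.

Lemma fold_parity_range (p : int * int) :
  esum p -> fold_parity (unfold_parity p) = p.
Proof.
case: p => d s; rewrite /fold_parity /unfold_parity /esum /=.
by case hd: ((d %% 2)%Z == 0) => hs; congr (_, _); lia.
Qed.

Lemma esum_fold_parity (p : int * int) : esum (fold_parity p).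
Proof. by case: p => d k; rewrite /esum /fold_parity /=; case: ifP => h; lia. Qed.

Lemma qexp_fold_parity (p : int * int) : qexp 0 2 (fold_parity p).2 = qexp 2 6 p.2.
Proof.
case: p => d k; rewrite /qexp /fold_parity /=; have h1 := tri_mul2 k.
case: ifP => _.
  have h2 := tri_mul2 (2 * k); nia.
have h2 := tri_mul2 (1 - 2 * k); nia.
Qed.

(* Substituting [s = i + j, d = i - j] in [A ^ 2] covers the lattice points
   with [s = d] mod 2, and [s = 1 - i - j, d = i - j] in [x * B ^ 2] the others. *)
Lemma theta_sqr_add (K : numFieldType) (e Q x : K) : geom_complete K ->
  e * e = 1 -> Q != 0 -> x != 0 -> `|Q| < 1 -> `|x| < 1 -> `|Q / x| < 1 ->
  theta (- (Q * x)) (- (Q ^+ 3 / x)) ^+ 2 +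
  e * x * theta (- (Q / x)) (- (Q ^+ 3 * x)) ^+ 2 =
  phi (- e * Q) * theta (e * x) (e * (Q ^+ 2 / x)).
Proof.
move=> hK ee Q0 x0 Q1 x1 Qx1.
have N1 : -1 * -1 = 1 :> K by rewrite mulrNN mulr1.
have e0 := sign_neq0 ee.
have ne : `|e| = 1.
  by apply/eqP; rewrite -(@pexpr_eq1 _ _ 2)// -normrX expr2 ee normr1.
have h2 : `|Q ^+ 2 / x| < 1 by rewrite expr2 -mulrA normrM mulr_ilt1.
have h3 : `|Q ^+ 3 / x| < 1 by rewrite exprS -mulrA normrM mulr_ilt1.
have h4 : `|Q ^+ 3 * x| < 1 by rewrite normrM normrX mulr_ilt1 ?exprn_ilt1 ?exprn_ge0.
have h5 : `|Q * x| < 1 by rewrite normrM mulr_ilt1.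
have V0 : x^-1 != 0 by rewrite invr_eq0.
have [|||| hA hA'] := @hasum_monomial K (-1) Q x (- (Q * x)) (- (Q ^+ 3 / x)) 1 3
  hK N1 Q0 x0; rewrite ?normrN//; [by rewrite expr1; ring|by ring|].
have [|||| hB hB'] := @hasum_monomial K (-1) Q x^-1 (- (Q / x)) (- (Q ^+ 3 * x)) 1 3
  hK N1 Q0 V0; rewrite ?normrN//; [by rewrite expr1; ring|by rewrite invrK; ring|].
have ee' : - e * - e = 1 by rewrite mulrNN.
have [|||| hP hP'] := @hasum_monomial K (- e) Q 1 (- e * Q) (- e * Q) 1 1
  hK ee' Q0 (oner_neq0 K); rewrite ?normrM ?normrN ?ne ?mul1r//;
  [by rewrite expr1; ring|by rewrite expr1 divr1|].
have [|||| hT hT'] := @hasum_monomial K e Q x (e * x) (e * (Q ^+ 2 / x)) 0 2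
  hK ee Q0 x0; rewrite ?(normrM e) ?ne ?mul1r//;
  [by rewrite expr0; ring|by ring|].
have hF := hasumM 0%Z 0%Z hP hT hP' hT'.
have hAA := hasumM 0%Z 0%Z hA hA hA' hA'.
have hBB := hasumZ (c := e * x) (hasumM 0%Z 0%Z hB hB hB' hB').
move: hF hAA hBB; set F := (fun p : int * int => _) => hF hAA hBB.
have {}hAA : hasum (fun p => if esum p then F p else 0)
    (theta (- (Q * x)) (- (Q ^+ 3 / x)) * theta (- (Q * x)) (- (Q ^+ 3 / x))).
  apply: (hasum_inj rot_evenK) => [p|].
    by case: ifP => // /rot_even_range ->; rewrite eqxx.
  apply: eq_hasum hAA => -[i j] /=.
  rewrite esum_even /F/= exp1rz mulr1 mulrA -mulrA [in RHS]mulrACA.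
  transitivity (((- e) ^ (i - j) * e ^ (i + j)) *
    (Q ^ qexp 1 1 (i - j) * Q ^ qexp 0 2 (i + j)) * x ^ (i + j)); last by ring.
  by rewrite -expfzDr// qexp_even sign_even// !expfzDr//; ring.
have {}hBB : hasum (fun p => if esum p then 0 else F p)
    (e * x * (theta (- (Q / x)) (- (Q ^+ 3 * x)) * theta (- (Q / x)) (- (Q ^+ 3 * x)))).
  apply: (hasum_inj rot_oddK) => [p|].
    by case: ifPn => // /rot_odd_range ->; rewrite eqxx.
  apply: eq_hasum hBB => -[i j] /=.
  rewrite esum_odd /F/= exp1rz mulr1.
  transitivity (((- e) ^ (i - j) * e ^ (1 - i - j)) *
    (Q ^ qexp 1 1 (i - j) * Q ^ qexp 0 2 (1 - i - j)) * x ^ (1 - i - j)); last by ring.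
  rewrite -expfzDr// qexp_odd sign_odd// !expfzDr// expr1z -!exprz_inv; ring.
rewrite !expr2; apply: hasum_unique hF.
by apply: eq_hasum (hasumD hAA hBB) => p; case: ifP; rewrite ?addr0 ?add0r.
Qed.

(* Each parity class of [s] in the sum over [s = d] mod 2 is a copy of the
   series of [psi (Q ^+ 2)]. *)
Lemma theta_mul (K : numFieldType) (Q x : K) : geom_complete K ->
  Q != 0 -> x != 0 -> `|Q| < 1 -> `|x| < 1 -> `|Q / x| < 1 ->
  theta (- (Q * x)) (- (Q ^+ 3 / x)) * theta (- (Q / x)) (- (Q ^+ 3 * x)) =
  psi (Q ^+ 2) * theta (- (Q / x)) (- (Q * x)).
Proof.
move=> hK Q0 x0 Q1 x1 Qx1.
have N1 : -1 * -1 = 1 :> K by rewrite mulrNN mulr1.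
have h2 : `|Q ^+ 2| < 1 by rewrite normrX exprn_ilt1.
have h3 : `|Q ^+ 3 / x| < 1 by rewrite exprS -mulrA normrM mulr_ilt1//
  expr2 -mulrA normrM mulr_ilt1.
have h4 : `|Q ^+ 3 * x| < 1 by rewrite normrM normrX mulr_ilt1 ?exprn_ilt1 ?exprn_ge0.
have h5 : `|Q * x| < 1 by rewrite normrM mulr_ilt1.
have h6 : `|(Q ^+ 2) ^+ 3| < 1 by rewrite normrX exprn_ilt1.
have V0 : x^-1 != 0 by rewrite invr_eq0.
have [|||| hA hA'] := @hasum_monomial K (-1) Q x (- (Q * x)) (- (Q ^+ 3 / x)) 1 3
  hK N1 Q0 x0; rewrite ?normrN//; [by rewrite expr1; ring|by ring|].
have [|||| hB hB'] := @hasum_monomial K (-1) Q x^-1 (- (Q / x)) (- (Q ^+ 3 * x)) 1 3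
  hK N1 Q0 V0; rewrite ?normrN//; [by rewrite expr1; ring|by rewrite invrK; ring|].
have [|||| hT hT'] := @hasum_monomial K (-1) Q x^-1 (- (Q / x)) (- (Q * x)) 1 1
  hK N1 Q0 V0; rewrite ?normrN//; [by rewrite expr1; ring|by rewrite expr1 invrK; ring|].
have [|||| hP hP'] := @hasum_monomial K 1 Q 1 (Q ^+ 2) ((Q ^+ 2) ^+ 3) 2 6
  hK (mul1r 1) Q0 (oner_neq0 K); rewrite ?mul1r ?mulr1 ?divr1//;
  first by rewrite -exprM.
have hBA := hasumM 0%Z 0%Z hB hA hB' hA'.
have hTP := hasumM 0%Z 0%Z hT hP hT' hP'.
pose F (p : int * int) := if esum p then
  (-1) ^ p.1 * Q ^ qexp 1 1 p.1 * x^-1 ^ p.1 * Q ^ qexp 0 2 p.2 else 0.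
(* With the series in [x^-1] first, the power of [x] is [x^-1 ^ (i - j)]: it depends on [d] alone,
   so the sum over [s] is free of [x]. *)
rewrite mulrC [RHS]mulrC; apply: (@hasum_unique _ _ F).
  apply: (hasum_inj rot_evenK) => [p|].
    by rewrite /F; case: ifP => // /rot_even_range ->; rewrite eqxx.
  apply: eq_hasum hBA => -[i j] /=; rewrite /F esum_even /=.
  have := sign_even i j (mul1r (1 : K)); rewrite exp1rz mulr1 => ->.
  transitivity ((-1) ^ i * (-1) ^ j * (Q ^ qexp 1 1 (i - j) * Q ^ qexp 0 2 (i + j))
    * x^-1 ^ (i - j)); last by ring.
  rewrite -[Q ^ _ * Q ^ _]expfzDr// qexp_even !expfzDr// [x^-1 ^ (- j)]exprz_inv opprK; ring.
apply: (hasum_inj fold_parityK) => [p|].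
  by rewrite /F; case: ifP => // /fold_parity_range ->; rewrite eqxx.
apply: eq_hasum hTP => p /=; rewrite /F esum_fold_parity qexp_fold_parity /=.
by rewrite !exp1rz mul1r mulr1.
Qed.

(** * The complex numbers, and the theorem *)

(** The telescoping series of [u] converges absolutely by comparison with a geometric one. *)
Lemma geom_complete_real (R : realType) (u : nat -> R) (C r : R) :
  0 <= r < 1 -> (forall n, `|u n.+1 - u n| <= C * r ^+ n) -> cvg (u @ \oo).
Proof.
move=> /andP[r0 r1] hu.
have C0 : 0 <= C by have := hu 0%N; rewrite expr0 mulr1; apply: le_trans.
have h : cvgn (series (telescope u)).
  apply: normed_cvg; apply: (@series_le_cvg _ _ (geometric C r)) => [n|n|n|].
  - exact: normr_ge0.
  - by rewrite /geometric /= mulr_ge0 ?exprn_ge0.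
  - exact: hu.
  - by apply: is_cvg_geometric_series; rewrite ger0_norm.
have -> : u = (fun n => u 0%N + series (telescope u) n).
  by apply/funext => n; rewrite -eq_sum_telescope.
by apply: is_cvgD => //; apply: is_cvg_cst.
Qed.

Lemma normc_real (R : rcfType) (x : R) : `|x%:C%C| = (`|x|)%:C%C.
Proof. by rewrite normc_def/= expr0n addr0 sqrtr_sqr. Qed.

Lemma normc_i (R : rcfType) : `|'i%C : R[i]| = 1.
Proof. by rewrite normc_def/= expr0n expr1n add0r sqrtr1. Qed.

Lemma normc_ge_Im (R : rcfType) (z : R[i]) : (`|complex.Im z|)%:C%C <= `|z|.
Proof.
have := normc_ge_Re (z * 'i%C).
by rewrite ReiNIm normrN normrM normc_i mulr1.
Qed.

Lemma normc_le_ReIm (R : rcfType) (z : R[i]) :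
  `|z| <= (`|complex.Re z| + `|complex.Im z|)%:C%C.
Proof.
rewrite {1}[z]complexE; apply: le_trans (ler_normD _ _) _.
by rewrite normrM normc_i mul1r !normc_real -rmorphD.
Qed.

Lemma geom_complete_complex (R : realType) : geom_complete R[i].
Proof.
move=> u C r hr hu; have /andP[r0 r1] := hr.
(* In the order of [R[i]], nonnegative elements are real, so [r] and [C] descend to [R]. *)
have er : r = (complex.Re r)%:C%C by rewrite RRe_real ?ger0_real.
have C0 : 0 <= C by have := hu 0%N; rewrite expr0 mulr1; apply: le_trans.
have eC : C = (complex.Re C)%:C%C by rewrite RRe_real ?ger0_real.
have hr' : 0 <= complex.Re r < 1 by rewrite -lecR -ltcR -er.
have le_part (f : R[i] -> R) : (forall z, (`|f z|)%:C%C <= `|z|) ->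
    (forall a b, f (a - b) = f a - f b) -> cvg ((f \o u) @ \oo).
  move=> fle fB; apply: (@geom_complete_real _ _ (complex.Re C) (complex.Re r)) => // n.
  rewrite /= -fB -lecR rmorphM rmorphXn/= -er -eC.
  exact: le_trans (fle _) (hu n).
have cRe := le_part _ (@normc_ge_Re R) (fun a b => raddfB _ a b).
have cIm := le_part _ (@normc_ge_Im R) (fun a b => raddfB _ a b).
set a := lim _ in cRe; set b := lim _ in cIm.
apply/cvg_ex; exists (a +i* b)%C; apply/cvgrPdist_lt => e e0.
have ee : e = (complex.Re e)%:C%C by rewrite RRe_real ?gtr0_real.
have e2 : 0 < complex.Re e / 2 by rewrite divr_gt0// -ltcR -ee.
move/cvgrPdist_lt: cRe => /(_ _ e2) cRe; move/cvgrPdist_lt: cIm => /(_ _ e2) cIm.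
apply: filterS2 cRe cIm => n /= h1 h2.
rewrite ee; apply: le_lt_trans (normc_le_ReIm _) _.
rewrite ltcR [X in _ < X](splitr (complex.Re e)); apply: ltrD.
  by move: h1; case: (u n).
by move: h2; case: (u n).
Qed.

(** In both theta functions the arguments multiply to [q ^+ 76], so the triple products share the
    nonzero factor [qpoch (q ^+ 76) (q ^+ 76)], which cancels. *)
Lemma Y_theta (K : numFieldType) (n : nat) (q : K) : geom_complete K ->
  0 < `|q| < 1 -> (1 <= n <= 9)%N ->
  Y n q = q ^+ n * (theta (- (q ^+ 19 / q ^+ (2 * n))) (- ((q ^+ 19) ^+ 3 * q ^+ (2 * n))) /
    theta (- (q ^+ 19 * q ^+ (2 * n))) (- ((q ^+ 19) ^+ 3 / q ^+ (2 * n)))).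
Proof.
move=> hK /andP[q0 q1] hn; rewrite normr_gt0 in q0.
have hx k m : (m <= k)%N -> q ^+ k / q ^+ m = q ^+ (k - m).
  by move=> mk; rewrite -{1}(subnK mk) exprD mulfK// expf_neq0.
have hX k : (0 < k)%N -> `|q ^+ k| < 1 by move=> k0; rewrite normrX exprn_ilt1// -lt0n.
rewrite -!exprM -!exprD !hx; try lia.
have -> : (19 * 3 + 2 * n = 57 + 2 * n)%N by lia.
have -> : (19 * 3 - 2 * n = 57 - 2 * n)%N by lia.
rewrite !jacobi_triple_product ?expf_neq0// ?hX//; try lia.
rewrite -!exprD.
have -> : (19 - 2 * n + (57 + 2 * n) = 76)%N by lia.
have -> : (19 + 2 * n + (57 - 2 * n) = 76)%N by lia.
have c0 : qpoch (q ^+ 76) (q ^+ 76) != 0 by apply: qpoch_neq0 => //; apply: hX.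
by rewrite /Y; congr (_ * _); rewrite -[RHS]mulf_div divff// mul1r.
Qed.

(* With the convention [x / 0 = 0], both sides are [0] when [u = 0] or [v = 0]. *)
Lemma inv_add_sign (K : fieldType) (e y u v : K) : y != 0 -> e * e = 1 ->
  (y * (u / v))^-1 + e * (y * (u / v)) =
  (v ^+ 2 + e * y ^+ 2 * u ^+ 2) / (y * (v * u)).
Proof.
move=> y0 ee; have [->|u0] := eqVneq u 0.
  by rewrite !(mul0r, mulr0, invr0) addr0.
have [->|v0] := eqVneq v 0.
  by rewrite !(mul0r, mulr0, invr0) addr0.
by field; rewrite y0 u0 v0.
Qed.

Lemma inv_Y_add_sign (K : numFieldType) (e : K) (n : nat) (q : K) :
  geom_complete K -> e * e = 1 -> 0 < `|q| < 1 -> (1 <= n <= 9)%N ->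
  (Y n q)^-1 + e * Y n q =
    (phi (- e * q ^+ 19) * theta (e * q ^+ (2 * n)) (e * q ^+ (38 - 2 * n))) /
    (q ^+ n * psi (q ^+ 38) *
     theta (- q ^+ (19 - 2 * n)) (- q ^+ (19 + 2 * n))).
Proof.
move=> hK ee hq hn; rewrite Y_theta//; have /andP[q0 q1] := hq.
rewrite normr_gt0 in q0.
have hx k m : (m <= k)%N -> q ^+ k / q ^+ m = q ^+ (k - m).
  by move=> mk; rewrite -{1}(subnK mk) exprD mulfK// expf_neq0.
have hX k : (0 < k)%N -> `|q ^+ k| < 1 by move=> k0; rewrite normrX exprn_ilt1// -lt0n.
(* Since [(q ^+ n) ^+ 2] is [x], the numerator and the denominator become the left sides of
   [theta_sqr_add] and [theta_mul]. *)
rewrite inv_add_sign ?expf_neq0// -[(q ^+ n) ^+ 2]exprM (mulnC n 2).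
have Q0 : q ^+ 19 != 0 by rewrite expf_neq0.
have x0 : q ^+ (2 * n) != 0 by rewrite expf_neq0.
have Q1 : `|q ^+ 19| < 1 by apply: hX.
have x1 : `|q ^+ (2 * n)| < 1 by apply: hX; lia.
have Qx1 : `|q ^+ 19 / q ^+ (2 * n)| < 1 by rewrite hx; [apply: hX|]; lia.
rewrite (theta_sqr_add hK ee Q0 x0 Q1 x1 Qx1) (theta_mul hK Q0 x0 Q1 x1 Qx1).
have -> : (q ^+ 19) ^+ 2 = q ^+ 38 by rewrite -exprM.
rewrite -exprD !hx; try lia.
by rewrite -[q ^+ n * _ * _]mulrA.
Qed.

Theorem theorem4p1 (R : realType) (q : R[i]) (hq : 0 < `|q| < 1)
    (n : nat) (hn : (1 <= n <= 9)%N) :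
  (Y n q)^-1 + Y n q =
    (phi (- q ^+ 19) * theta (q ^+ (2 * n)) (q ^+ (38 - 2 * n))) /
    (q ^+ n * psi (q ^+ 38) *
     theta (- q ^+ (19 - 2 * n)) (- q ^+ (19 + 2 * n)))
  /\
  (Y n q)^-1 - Y n q =
    (phi (q ^+ 19) * theta (- q ^+ (2 * n)) (- q ^+ (38 - 2 * n))) /
    (q ^+ n * psi (q ^+ 38) *
     theta (- q ^+ (19 - 2 * n)) (- q ^+ (19 + 2 * n))).
Proof.
have hK := @geom_complete_complex R.
have h1 : 1 * 1 = 1 :> R[i] by rewrite mul1r.
have hN1 : -1 * -1 = 1 :> R[i] by rewrite mulrNN mul1r.
split.
  by have := inv_Y_add_sign hK h1 hq hn; rewrite !mul1r mulN1r.
by have := inv_Y_add_sign hK hN1 hq hn; rewrite !mulN1r opprK mul1r.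
Qed.
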